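(* Let $\mathcal{I}$ be an admissible ideal of subsets of $\mathbb{N}$, let $(\mathcal{X},\delta)$ be a metric-like space and let $x_o$ be an isolated point of $\mathcal{X}$. If a sequence $\{x_n\}_{n\in\mathbb{N}}$ in $\mathcal{X}$ is $\mathcal{I}$-convergent to $x_o$, then $\{x_n\}_{n\in\mathbb{N}}$ is $\mathcal{I}^{*}$-convergent to $x_o$.
   Context: A metric-like space is a pair $(\mathcal{X},\delta)$ where $\mathcal{X}$ is a non-empty set and $\delta:\mathcal{X}\times\mathcal{X}\to\mathbb{R}_{\ge 0}$ satisfies, for all $x,y,z\in\mathcal{X}$: (1) $\delta(x,y)=0\Rightarrow x=y$; (2) $\delta(x,y)=\delta(y,x)$; (3) $\delta(x,y)\le\delta(x,z)+\delta(z,y)$. The value $\delta(x,x)$ may be positive. For $x_o\in\mathcal{X}$ and $\epsilon>0$ the open $\delta$-ball is $\mathcal{B}_\delta(x_o;\epsilon)=\{x\in\mathcal{X}: |\delta(x,x_o)-\delta(x_o,x_o)|<\epsilon\}$. A point $x_o\in\mathcal{X}$ is an isolated point of $\mathcal{X}$ if there exists $r_o>0$ such that $\mathcal{B}_\delta(x_o;r_o)=\{x_o\}$. An ideal in $\mathbb{N}$ is a non-empty class $\mathcal{I}$ of subsets of $\mathbb{N}$ containing $\emptyset$, closed under finite unions and under taking subsets. It is admissible if $\mathbb{N}\notin\mathcal{I}$, $\mathcal{I}\ne\{\emptyset\}$, and $\{z\}\in\mathcal{I}$ for every $z\in\mathbb{N}$. The associated filter is $\mathcal{F}(\mathcal{I})=\{\mathbb{N}\setminus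 A: A\in\mathcal{I}\}$. A sequence $\{x_n\}$ in $(\mathcal{X},\delta)$ is $\mathcal{I}$-convergent to $x_o\in\mathcal{X}$ if for every $\epsilon>0$ the set $\{n\in\mathbb{N}: |\delta(x_n,x_o)-\delta(x_o,x_o)|\ge\epsilon\}$ belongs to $\mathcal{I}$. It is $\mathcal{I}^{*}$-convergent to $x_o\in\mathcal{X}$ if there exists $M=\{n_1<n_2<\cdots\}\in\mathcal{F}(\mathcal{I})$ such that $\lim_{k\to\infty}\delta(x_{n_k},x_o)=\delta(x_o,x_o)$. *)

(* Defs.v *)
From mathcomp Require Import all_boot all_order all_algebra.
From mathcomp Require Import all_classical all_reals all_analysis.

Set Implicit Arguments.
Unset Strict Implicit.
Unset Printing Implicit Defensive.

Import Order.TTheory GRing.Theory Num.Theory.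
Import numFieldNormedType.Exports.

Local Open Scope classical_set_scope.
Local Open Scope ring_scope.

(* The self-distance [delta x x] is not required to vanish. *)
Record metric_like (R : realType) (X : Type) (delta : X -> X -> R) : Prop :=
  MetricLike {
    ml_nonempty : [set: X] !=set0;
    ml_ge0 : forall x y, 0 <= delta x y;
    ml_eq0 : forall x y, delta x y = 0 -> x = y;
    ml_sym : forall x y, delta x y = delta y x;
    ml_triangle : forall x y z, delta x y <= delta x z + delta z y
  }.

Definition ml_ball (R : realType) (X : Type) (delta : X -> X -> R)
    (xo : X) (eps : R) : set X :=
  [set x | `|delta x xo - delta xo xo| < eps].

(* Stated with the open balls of [delta], which need not be those of a
   metric; the library's topological notion of isolated point is not used. *)
Definition ml_isolated (R : realType) (X : Type) (delta : X -> X -> R)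
    (xo : X) : Prop :=
  exists2 r : R, 0 < r & ml_ball delta xo r = [set xo].

Record set_ideal (I : set (set nat)) : Prop := SetIdeal {
  ideal_nonempty : I !=set0;
  ideal_set0 : I set0;
  ideal_setU : forall A B, I A -> I B -> I (A `|` B);
  ideal_subset : forall A B, A `<=` B -> I B -> I A
}.

Record admissible_ideal (I : set (set nat)) : Prop := AdmissibleIdeal {
  admissible_set_ideal : set_ideal I;
  admissible_proper : ~ I [set: nat];
  admissible_nontrivial : I <> [set set0];
  admissible_set1 : forall z : nat, I [set z]
}.

Definition ideal_filter (I : set (set nat)) : set (set nat) :=
  [set ~` A | A in I].

Definition ideal_cvg (R : realType) (X : Type) (delta : X -> X -> R)
    (I : set (set nat)) (x : nat -> X) (xo : X) : Prop :=
  forall eps : R, 0 < eps ->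
    I [set n | eps <= `|delta (x n) xo - delta xo xo|].

(* [range nu] is the set M = {n_1 < n_2 < ...}, with [nu k] its (k+1)-st
   element. *)
Definition ideal_star_cvg (R : realType) (X : Type) (delta : X -> X -> R)
    (I : set (set nat)) (x : nat -> X) (xo : X) : Prop :=
  exists nu : nat -> nat,
    [/\ {homo nu : m n / (m < n)%N},
        ideal_filter I (range nu) &
        (fun k => delta (x (nu k)) xo) @ \oo --> delta xo xo].

(* Main.v *)
(** The set of indices [n] with [x n = xo] contains, for [r] a radius
    isolating [xo], the complement of the exceptional set
    [{n | r <= |delta (x n) xo - delta xo xo|}] and hence lies in the filter.
    It is unbounded because an admissible ideal contains every finite set but
    not the whole of [nat], and along its increasing enumeration the distance
    to [xo] is constantly [delta xo xo]. *)
Require Import Defs.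
From mathcomp Require Import all_boot all_order all_algebra.
From mathcomp Require Import all_classical all_reals all_analysis.

Set Implicit Arguments.
Unset Strict Implicit.
Unset Printing Implicit Defensive.

Import Order.TTheory GRing.Theory Num.Theory.
Import numFieldNormedType.Exports.

Local Open Scope classical_set_scope.

(** Start from the least element of [M] and repeatedly pass to the least element of [M] beyond the
    current one: unboundedness keeps the process going, and minimality ensures that nothing is
    skipped. *)
Lemma unbounded_enum (M : set nat) :
  (forall N : nat, exists2 n, (N <= n)%N & M n) ->
  exists2 nu : nat -> nat, {homo nu : m n / (m < n)%N} & range nu = M.
Proof.
move=> Munb.
have least N : {n | [/\ (N <= n)%N, M n &
    forall m, (N <= m)%N -> M m -> (n <= m)%N]}.
  have ex : exists n, (N <= n)%N && `[< M n >].
    by have [n Nn Mn] := Munb N; exists n; rewrite Nn; apply/asboolP.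
  case: (ex_minnP ex) => n /andP[Nn /asboolP Mn] nmin.
  by exists n; split=> // m Nm Mm; apply: nmin; rewrite Nm; apply/asboolP.
pose next N := sval (least N).
have next_ge N : (N <= next N)%N by have [] := svalP (least N).
have next_mem N : M (next N) by have [] := svalP (least N).
have next_min N m : (N <= m)%N -> M m -> (next N <= m)%N.
  by have [_ _] := svalP (least N); apply.
pose nu k := iter k (fun m => next m.+1) (next 0%N).
have nu_lt k : (nu k < nu k.+1)%N by apply: next_ge.
exists nu; first exact: (homo_ltn ltn_trans).
apply/seteqP; split=> [_ [[|k] _ <-]|m Mm]; [exact: next_mem..|].
have nu_ge k : (k <= nu k)%N.
  by elim: k => // k IHk; apply: leq_ltn_trans IHk (nu_lt k).
(* For the least [k] with [m <= nu k], either [k] is [0] or the preceding value of [nu] is below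
   [m]. Hence [m] is among the candidates of which [nu k] is the least, so [nu k <= m]. *)
have ex : exists k, (m <= nu k)%N by exists m.
case: (ex_minnP ex) => -[|k] le_m kmin; [exists 0%N | exists k.+1] => //.
all: apply/eqP; rewrite eqn_leq le_m andbT; apply: next_min => //.
by rewrite ltnNge; apply/negP => /kmin; rewrite ltnn.
Qed.

Lemma admissible_below (I : set (set nat)) (N : nat) :
  admissible_ideal I -> I [set n | (n < N)%N].
Proof.
move=> [hI _ _ I1]; elim: N => [|N IHN].
  by apply: ideal_subset (ideal_set0 hI).
apply: ideal_subset (ideal_setU hI IHN (I1 N)) => // n /=.
by rewrite ltnS leq_eqVlt => /orP[/eqP|]; [right|left].
Qed.

(** If [M] had no element from [N] on, its complement, which lies in [I], and the initial segment
    below [N] would together cover [nat], contradicting properness. *)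
Lemma ideal_filter_unbounded (I : set (set nat)) (M : set nat) (N : nat) :
  admissible_ideal I -> ideal_filter I M -> exists2 n, (N <= n)%N & M n.
Proof.
move=> hI [A IA <-]; apply: contrapT => noM.
have hid := admissible_set_ideal hI.
apply: (admissible_proper hI).
apply: ideal_subset (ideal_setU hid IA (admissible_below N hI)) => // n _.
have [An|nAn] := pselect (A n); [by left|right].
by rewrite /= ltnNge; apply/negP => Nn; apply: noM; exists n.
Qed.

Theorem theorem4p3 (R : realType) (I : set (set nat)) (hI : admissible_ideal I)
    (X : Type) (delta : X -> X -> R) (hdelta : metric_like delta)
    (xo : X) (hxo : ml_isolated delta xo) (x : nat -> X) :
  ideal_cvg delta I x xo -> ideal_star_cvg delta I x xo.
Proof.
move=> cvgx; have [r r0 ballr] := hxo.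
pose M := [set n | x n = xo].
have FM : ideal_filter I M.
  exists (~` M); last exact: setCK.
  apply: ideal_subset (cvgx r r0); first exact: admissible_set_ideal hI.
  move=> n /= xn; rewrite leNgt; apply/negP => lt_r; apply: xn.
  by have : ml_ball delta xo r (x n) by []; rewrite ballr.
have [nu nu_lt rnu] : exists2 nu : nat -> nat,
    {homo nu : m n / (m < n)%N} & range nu = M.
  by apply: unbounded_enum => N; exact: ideal_filter_unbounded hI FM.
exists nu; split=> //; first by rewrite rnu.
have xnu k : x (nu k) = xo by have : M (nu k) by rewrite -rnu; exists k.
by under eq_fun do rewrite xnu; exact: cvg_cst.
Qed.
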